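(* Let $n\ge2$ and let $-1\le\alpha<\beta\le1$ with $\beta^2\ge\alpha^2$. Let $B_{\alpha\beta}=\{x\in\mathbb{R}^n:\|x\|\le1,\ \alpha\le x_1\le\beta\}$. The minimum volume covering ellipsoid problem for $B_{\alpha\beta}$ can be formulated as the nonlinear programming problem, in the decision variables $(a,b,\tau)$ with $a>0$, $b>0$, $\tau\in\mathbb{R}$, $$\begin{aligned}\min\quad&-\ln a-(n-1)\ln b\\ \text{s.t.}\quad& a\tau-\tfrac{\alpha+\beta}{2}(a-b)=0,\\ & a\tau^2+b-1-\alpha\beta(a-b)=0,\\ &-a+b\le0,\end{aligned}$$ that is, $(a,b,\tau)$ is an optimal solution of this problem if and only if $\mathrm{CE}(B_{\alpha\beta})=E(\mathrm{diag}(a,b,\ldots,b),\tau e_1)$. Its solution is the following: (i) if $\alpha\beta\le-1/n$, then $\tau=0$ and $a=b=1$; (ii) if $\alpha+\beta=0$ and $\alpha\beta>-1/n$, then $\tau=0$, $a=\frac{1}{n\beta^2}$, $b=\frac{n-1}{n(1-\beta^2)}$; (iii) if $\alpha+\beta\ne0$ and $\alpha\beta>-1/n$, then $$\tau=\frac{n(\beta+\alpha)^2+2(1+\alpha\beta)-\sqrt{\Delta}}{2(n+1)(\beta+\alpha)},\qquad a=\frac{1}{n(\tau-\alpha)(\beta-\tau)},\qquad b=\frac{1-a(\tau-\alpha)^2}{1-\alpha^2},$$ where $\Delta=n^2(\beta^2-\alpha^2)^2+4(1-\alpha^2)(1-\beta^2)$.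
   Context: For a symmetric positive definite $n\times n$ matrix $X$ and $c\in\mathbb{R}^n$, $E(X,c)=\{x\in\mathbb{R}^n:\langle X(x-c),x-c\rangle\le 1\}$. A convex body is a compact convex set with nonempty interior. For a convex body $K\subset\mathbb{R}^n$, $\mathrm{CE}(K)$ denotes the unique ellipsoid of minimum volume containing $K$. $e_1=(1,0,\ldots,0)^T$. *)

(* Defs.v *)
From HB Require Import structures.
From mathcomp Require Import all_boot all_order all_algebra.
From mathcomp Require Import all_classical all_reals all_analysis.

Set Implicit Arguments.
Unset Strict Implicit.
Unset Printing Implicit Defensive.

Import Order.TTheory GRing.Theory Num.Theory.
Import numFieldNormedType.Exports.

Local Open Scope classical_set_scope.
Local Open Scope ring_scope.

Section power_measure.
Context d (T : measurableType d) (R : realType).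
Variable m : {sigma_finite_measure set T -> \bar R}.

Definition tcons (n : nat) (p : T * n.-tuple T) : n.+1.-tuple T :=
  [the n.+1.-tuple T of p.1 :: p.2].

Lemma measurable_tcons (n : nat) :
  measurable_fun [set: T * n.-tuple T] (@tcons n).
Proof. exact: (measurable_cons measurable_fst measurable_snd). Qed.

Section step.
Variables (n : nat) (mu : {sigma_finite_measure set (n.-tuple T) -> \bar R}).

Definition power_step : set (n.+1.-tuple T) -> \bar R :=
  pushforward (m \x mu)%E (@tcons n).

Let power_step0 : power_step set0 = 0%E.
Proof. by rewrite /power_step /pushforward preimage_set0 measure0. Qed.

Let power_step_ge0 A : (0 <= power_step A)%E.
Proof. by rewrite /power_step /pushforward measure_ge0. Qed.

Let power_step_sigma_additive : semi_sigma_additive power_step.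
Proof.
move=> F mF tF mUF; rewrite /power_step /pushforward preimage_bigcup.
have mp A : measurable A -> measurable (@tcons n @^-1` A).
  by move=> mA; rewrite -[X in measurable X]setTI; exact: measurable_tcons.
apply: measure_semi_sigma_additive.
- by move=> i; exact: mp.
- apply/trivIsetP => /= i j _ _ ij; rewrite -preimage_setI.
  by move/trivIsetP : tF => /(_ _ _ _ _ ij) ->//; rewrite preimage_set0.
- by rewrite -preimage_bigcup; exact: mp.
Qed.

HB.instance Definition _ := isMeasure.Build _ _ _ power_step
  power_step0 power_step_ge0 power_step_sigma_additive.

Let power_step_sigma_finite : sigma_finite setT power_step.
Proof.
have /sigma_finiteP[F [FT ndF Foo]] := sigma_finiteT m.
have /sigma_finiteP[G [GT ndG Goo]] := sigma_finiteT mu.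
pose g (t : n.+1.-tuple T) : T * n.-tuple T := (thead t, [tuple of behead t]).
have mg : measurable_fun setT g.
  apply: measurable_fun_pair; last exact: measurable_behead.
  exact: measurable_tnth.
have gK p : g (@tcons n p) = p.
  by case: p => x t; rewrite /g /tcons /=; congr (_, _); exact/val_inj.
exists (fun i => g @^-1` (F i `*` G i)).
  rewrite -preimage_bigcup -[LHS](preimage_setT g); congr (_ @^-1` _).
  rewrite -setXTT FT GT predeqE => -[x y]; split.
    move=> [/= [i _ Fix] [j _ Gjy]]; exists (maxn i j) => //; split => /=.
    - by move: x Fix; exact/subsetPset/ndF/leq_maxl.
    - by move: y Gjy; exact/subsetPset/ndG/leq_maxr.
  by move=> [i _ []/= ? ?]; split; exists i.
move=> i; have [? ?] := Foo i; have [? ?] := Goo i; split.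
  by rewrite -[X in measurable X]setTI; apply: mg => //; exact: measurableX.
rewrite /power_step /pushforward -comp_preimage.
rewrite (_ : g \o @tcons n = id); last by apply/funext => p /=; rewrite gK.
by rewrite preimage_id product_measure1E// lte_mul_pinfty// ge0_fin_numE.
Qed.

HB.instance Definition _ := Measure_isSigmaFinite.Build _ _ _ power_step
  power_step_sigma_finite.

End step.

(* The product measure of n copies of m on T^n; the product over no factor is
   the Dirac mass at the empty tuple. *)
Fixpoint power_measure (n : nat) :
    {sigma_finite_measure set (n.-tuple T) -> \bar R} :=
  match n with
  | 0 => [the {sigma_finite_measure set (0.-tuple T) -> \bar R} of
            \d_([tuple] : 0.-tuple T)]
  | k.+1 => [the {sigma_finite_measure set (k.+1.-tuple T) -> \bar R} of
            power_step (power_measure k)]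
  end.

End power_measure.

Definition volume (R : realType) (n : nat) (A : set 'cV[R]_n) : \bar R :=
  power_measure (@lebesgue_measure R) n [set t | A (\col_(i < n) tnth t i)].

Definition dot (R : realType) (n : nat) (x y : 'cV[R]_n) : R :=
  \sum_(i < n) x i 0 * y i 0.

(* The library norm on matrices is the sup norm, hence this definition. *)
Definition enorm (R : realType) (n : nat) (x : 'cV[R]_n) : R :=
  Num.sqrt (dot x x).

Definition symposdef (R : realType) (n : nat) (X : 'M[R]_n) : Prop :=
  X^T = X /\ forall x : 'cV[R]_n, x != 0 -> 0 < dot (X *m x) x.

Definition E (R : realType) (n : nat) (X : 'M[R]_n) (c : 'cV[R]_n) :
    set 'cV[R]_n :=
  [set x | dot (X *m (x - c)) (x - c) <= 1].

Definition ellipsoid (R : realType) (n : nat) (S : set 'cV[R]_n) : Prop :=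
  exists X : 'M[R]_n, exists c : 'cV[R]_n, symposdef X /\ S = E X c.

Definition min_volume_covering (R : realType) (n : nat)
    (K S : set 'cV[R]_n) : Prop :=
  [/\ ellipsoid S, K `<=` S &
      forall S' : set 'cV[R]_n, ellipsoid S' -> K `<=` S' ->
        (volume S <= volume S')%E].

(* The default value set0 is not an ellipsoid, so an equation CE K = E X c with
   X positive definite does assert that E X c is the unique minimizer. *)
Definition CE (R : realType) (n : nat) (K : set 'cV[R]_n) : set 'cV[R]_n :=
  xget set0 [set S | min_volume_covering K S /\
                     forall S', min_volume_covering K S' -> S' = S].

(* The coordinate x_1 is the entry of index 0. *)
Definition e1 (R : realType) (n : nat) : 'cV[R]_n :=
  \col_(i < n) (i == 0 :> nat)%:R.

Definition diag1 (R : realType) (n : nat) (a b : R) : 'M[R]_n :=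
  diag_mx (\row_(i < n) if i == 0 :> nat then a else b).

Definition Bab (R : realType) (n : nat) (alpha beta : R) : set 'cV[R]_n :=
  [set x | enorm x <= 1 /\
           forall i : 'I_n, i = 0 :> nat -> alpha <= x i 0 <= beta].
Arguments Bab {R} n alpha beta _.

Definition nlp_objective (R : realType) (n : nat) (a b : R) : R :=
  - ln a - (n%:R - 1) * ln b.

Definition nlp_feasible (R : realType) (alpha beta a b tau : R) : Prop :=
  [/\ 0 < a, 0 < b,
      a * tau - (alpha + beta) / 2 * (a - b) = 0,
      a * tau ^+ 2 + b - 1 - alpha * beta * (a - b) = 0 &
      - a + b <= 0].

Definition nlp_optimal (R : realType) (n : nat) (alpha beta a b tau : R) :
    Prop :=
  nlp_feasible alpha beta a b tau /\
  forall a' b' tau' : R, nlp_feasible alpha beta a' b' tau' ->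
    nlp_objective n a b <= nlp_objective n a' b'.

(* Main.v *)
From HB Require Import structures.
Require Import Defs.
From mathcomp Require Import all_boot all_order all_algebra.
From mathcomp Require Import all_classical all_reals all_analysis.
From mathcomp Require Import measurable_realfun ring lra.

Import Order.TTheory GRing.Theory Num.Theory.
Import numFieldNormedType.Exports.

Local Open Scope ring_scope.

(* Since E(X, c) has volume vol(unit ball) / sqrt (det X), the covering problem
   maximizes det X.  If E(X, c) covers B_{al,be}, then averaging the inequality
   <X (w - c), w - c> <= 1 over the contact points
   w = ga e_1 +- sqrt (1 - ga^2) e_j, first over the signs and j, then over
   ga = al, be with weights of mean tau, gives
     n <X (tau e_1 - c), tau e_1 - c> + X_11 / a + sum_(j > 1) X_jj / b <= n
   as soon as n (be - tau) (tau - al) a = 1 and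
   n (1 - (al + be) tau + al be) b = n - 1.  Hadamard's inequality and AM-GM then
   give det X <= a b^(n - 1), with equality only for X = diag(a, b, ..., b) and
   c = tau e_1.  As feasible points of the nonlinear program are covering
   ellipsoids, the same bound settles the program without any calculus. *)

(** * Positive definite forms and Hadamard's inequality *)

Section Dot.
Context {R : realType}.

Lemma dotE n (x y : 'cV[R]_n) : dot x y = (x^T *m y) 0 0.
Proof. by rewrite mxE; apply: eq_bigr => i _; rewrite mxE. Qed.

Lemma dotC n (x y : 'cV[R]_n) : dot x y = dot y x.
Proof. by apply: eq_bigr => i _; rewrite mulrC. Qed.

Lemma dotDl n (x y z : 'cV[R]_n) : dot (x + y) z = dot x z + dot y z.
Proof. by rewrite !dotE linearD mulmxDl mxE. Qed.

Lemma dotZl n a (x z : 'cV[R]_n) : dot (a *: x) z = a * dot x z.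
Proof. by rewrite !dotE linearZ -scalemxAl mxE. Qed.

Lemma dotDr n (x y z : 'cV[R]_n) : dot z (x + y) = dot z x + dot z y.
Proof. by rewrite !(dotC n z) dotDl. Qed.

Lemma dotZr n a (x z : 'cV[R]_n) : dot z (a *: x) = a * dot z x.
Proof. by rewrite !(dotC n z) dotZl. Qed.

Lemma dot0r n (x : 'cV[R]_n) : dot x 0 = 0.
Proof. by rewrite -(scale0r 0) dotZr mul0r. Qed.

Lemma dot_trmx n (A : 'M[R]_n) (x y : 'cV[R]_n) :
  dot (A *m x) y = dot x (A^T *m y).
Proof. by rewrite !dotE trmx_mul mulmxA. Qed.

Lemma dot_col_mx m n (a c : 'cV[R]_m) (b d : 'cV[R]_n) :
  dot (col_mx a b) (col_mx c d) = dot a c + dot b d.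
Proof. by rewrite !dotE tr_col_mx mul_row_col mxE. Qed.

Lemma dot_scalar (a : R) : dot (a%:M : 'cV_1) a%:M = a ^+ 2.
Proof. by rewrite /dot big_ord1 mxE eqxx mulr1n expr2. Qed.

Lemma dot_ge0 n (x : 'cV[R]_n) : 0 <= dot x x.
Proof. by apply: sumr_ge0 => i _; exact: sqr_ge0. Qed.

Lemma dot_eq0 n (x : 'cV[R]_n) : (dot x x == 0) = (x == 0).
Proof.
apply/eqP/eqP => [|->]; last exact: dot0r.
move=> /psumr_eq0P h; apply/colP => i; rewrite mxE.
by apply/eqP; rewrite -sqrf_eq0 expr2 h// => j _; exact: sqr_ge0.
Qed.

End Dot.

Section PositiveDefinite.
Context {R : realType}.

Lemma symposdef_ge0 n (X : 'M[R]_n) x : symposdef X -> 0 <= dot (X *m x) x.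
Proof.
move=> [_ h]; have [->|/h/ltW//] := eqVneq x 0.
by rewrite mulmx0 dot0r.
Qed.

Lemma symposdef_eq0 n (X : 'M[R]_n) x :
  symposdef X -> dot (X *m x) x <= 0 -> x = 0.
Proof.
move=> [_ h] hx; apply/eqP; apply: contraTT hx => /h; by rewrite -ltNge.
Qed.

Lemma symposdef_unit n (X : 'M[R]_n) : symposdef X -> X \in unitmx.
Proof.
move=> [sX pX]; rewrite -row_free_unit -kermx_eq0; apply/negPn/negP => h.
(* A nonzero vector of the left kernel would be a nonzero vector on which the form vanishes. *)
have /pX : (nz_row (kermx X))^T != 0.
  by rewrite -(inj_eq trmx_inj) trmxK trmx0 nz_row_eq0.
have /sub_kermxP e := nz_row_sub (kermx X).
by rewrite -{1}sX -trmx_mul e trmx0 dotC dot0r ltxx.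
Qed.

(* Completing the square: X is congruent to diag(s, Y) through shear w. *)
Definition shear n (w : 'cV[R]_n) : 'M[R]_(1 + n) := block_mx 1%:M 0 w 1%:M.

Lemma schur_complement n (X : 'M[R]_(1 + n)) : symposdef X ->
  exists (s : R) (w : 'cV[R]_n) (Y : 'M[R]_n),
  [/\ 0 < s, symposdef Y &
      X = (shear n w)^T *m block_mx s%:M 0 0 Y *m shear n w].
Proof.
move=> hX; have [sX pX] := hX.
have sX' := sX; rewrite -(submxK X) tr_block_mx in sX'.
have [_ sur _ sY] := eq_block_mx sX'.
have hY : symposdef (drsubmx X).
  split => // y y0.
  have /pX : col_mx 0 y != 0 :> 'cV_(1 + n).
    by apply: contra_neq y0 => /(congr1 dsubmx); rewrite col_mxKd linear0.
  rewrite -{1}(submxK X) mul_block_col !mulmx0 !add0r dot_col_mx.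
  by rewrite dot0r add0r.
have uY := symposdef_unit _ _ hY.
(* With this [w] the shear absorbs the off-diagonal blocks; [s] is the Schur complement of the lower
   right block. *)
pose w := invmx (drsubmx X) *m dlsubmx X.
have Yw : drsubmx X *m w = dlsubmx X by rewrite mulmxA mulmxV ?mul1mx.
have wY : w^T *m drsubmx X = ursubmx X.
  by rewrite -{1}sY -trmx_mul Yw sur.
pose s := (ulsubmx X - w^T *m dlsubmx X) 0 0.
have XE : X = (shear n w)^T *m block_mx s%:M 0 0 (drsubmx X) *m shear n w.
  rewrite tr_block_mx !trmx0 !trmx1 !mulmx_block.
  rewrite !(mul0mx, mulmx0, mul1mx, mulmx1, addr0, add0r).
  rewrite wY Yw /s -mx11_scalar.
  rewrite -[LHS](submxK X); congr block_mx.
  by rewrite -wY -mulmxA Yw subrK.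
exists s, w, (drsubmx X); split => //.
(* The shear sends this vector to the first basis vector, so the form takes the value [s] on it. *)
have /pX : col_mx 1%:M (- w) != 0 :> 'cV_(1 + n).
  apply/eqP => /(congr1 usubmx); rewrite col_mxKu linear0.
  by move/matrixP/(_ 0 0); rewrite !mxE/= => /eqP; rewrite oner_eq0.
rewrite {1}XE -!mulmxA dot_trmx trmxK !mul_block_col.
rewrite !(mulmx0, mul0mx, mul1mx, mulmx1, addr0, add0r) subrr.
rewrite mulmx0 dot_col_mx dot0r addr0 dotC dotE trmx1 mul1mx mxE eqxx.
by [].
Qed.

Lemma schur_complement_dot n s (w : 'cV[R]_n) (Y : 'M[R]_n) x0 x :
  dot ((shear n w)^T *m block_mx s%:M 0 0 Y *m shear n w *m col_mx x0%:M x)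
    (col_mx x0%:M x)
  = s * x0 ^+ 2 + dot (Y *m (x + x0 *: w)) (x + x0 *: w).
Proof.
rewrite -!mulmxA dot_trmx trmxK !mul_block_col.
rewrite !(mul0mx, mul1mx, addr0, add0r) dot_col_mx.
by rewrite mul_scalar_mx mul_mx_scalar [_ + x]addrC dotZl dot_scalar.
Qed.

End PositiveDefinite.

Section Hadamard.
Context {R : realType}.

Lemma det_schur n s (w : 'cV[R]_n) (Y : 'M[R]_n) :
  \det ((shear n w)^T *m block_mx s%:M 0 0 Y *m shear n w) = s * \det Y.
Proof.
rewrite !det_mulmx det_tr !det_lblock !det_scalar1.
by rewrite !det1 !(mulr1, mul1r).
Qed.

(** Induction on the dimension: the determinant is [s * \det Y], while the corner entry of [X] is
    [s] plus the value of [Y] at [w]. Equality therefore forces [w = 0], and the off-diagonal blocks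
    vanish. *)
Lemma hadamard n (X : 'M[R]_n) : symposdef X ->
  [/\ 0 < \det X, forall i, 0 < X i i, \det X <= \prod_i X i i &
      \det X = \prod_i X i i -> forall i j, i != j -> X i j = 0].
Proof.
elim: n X => [|n IH].
  by move=> X _; rewrite det_mx00 big_ord0; split => // [[]|_ []].
rewrite -add1n => X hX.
have [s [w [Y [s0 hY XE]]]] := schur_complement n X hX.
have {IH} [dY dgY leY eqY] := IH _ hY.
have detX : \det X = s * \det Y by rewrite XE; exact: det_schur.
have {}XE : X = block_mx (s%:M + w^T *m Y *m w) (w^T *m Y) (Y *m w) Y.
  rewrite XE tr_block_mx !trmx0 !trmx1 !mulmx_block.
  by rewrite !(mul0mx, mulmx0, mul1mx, mulmx1, addr0, add0r).
have X00 : X (lshift n 0) (lshift n 0) = s + dot (Y *m w) w.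
  rewrite XE block_mxEul [LHS]mxE !mxE eqxx mulr1n.
  by congr (_ + _); rewrite dotE trmx_mul hY.1 mxE.
have Xii i : X (rshift 1 i) (rshift 1 i) = Y i i by rewrite XE block_mxEdr.
have wY0 := symposdef_ge0 _ _ w hY.
have pY : 0 < \prod_i Y i i by apply: prodr_gt0.
rewrite big_split_ord big_ord1/= (eq_bigr _ (fun i _ => Xii i)) X00 detX.
split.
- exact: mulr_gt0.
- move=> i; have [j ->|j ->] := split_ordP i; last by rewrite Xii.
  by rewrite [j]ord1 X00 ltr_wpDr.
- by apply: ler_pM => //; [exact/ltW|exact/ltW|rewrite lerDl].
- move=> e.
  (* Equality together with [leY] shows that the form value at [w] times the product of the diagonal
     of [Y] is at most 0. *)
  have w0 : w = 0.
    apply: (symposdef_eq0 _ _ _ hY); rewrite -(pmulr_lle0 _ pY).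
    have := ler_wpM2l (ltW s0) leY; rewrite e mulrDl; lra.
  have {}eqY : forall i j, i != j -> Y i j = 0.
    apply: eqY; apply: (mulfI (lt0r_neq0 s0)).
    by rewrite e w0 mulmx0 dot0r addr0.
  rewrite XE w0 !mulmx0 trmx0 !mul0mx => i j.
  have [i' ->|i' ->] := split_ordP i; have [j' ->|j' ->] := split_ordP j.
  + by rewrite [i']ord1 [j']ord1 eqxx.
  + by rewrite block_mxEur mxE.
  + by rewrite block_mxEdl mxE.
  + by rewrite block_mxEdr (inj_eq (@rshift_inj _ _)) => /eqY.
Qed.

End Hadamard.

(** * Volume of ellipsoids *)

Section Affine.
Local Open Scope classical_set_scope.
Context {R : realType}.
Notation mu := (@lebesgue_measure R).

Lemma measurable_affine (k c : R) :
  measurable_fun [set: R] (fun x : R => k * (x - c)).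
Proof. by apply: measurable_funM => //; apply: measurable_funB. Qed.

(** Change of variables: [k] times the image of Lebesgue measure under the affine map gives every
    half-open interval its length, so by uniqueness it is Lebesgue measure. *)
Lemma ge0_integral_affine (k c : R) (f : R -> \bar R) : 0 < k ->
  measurable_fun setT f -> (forall x, 0 <= f x)%E ->
  (\int[mu]_x f x = k%:E * \int[mu]_x f (k * (x - c))%R)%E.
Proof.
move=> k0 mf f0.
pose phi (x : measurableTypeR R) : measurableTypeR R := k * (x - c).
have mphi : measurable_fun setT phi by exact: measurable_affine.
pose nu0 : {measure set (measurableTypeR R) -> \bar R} :=
  measure_function_pushforward__canonical__measure_function_Measure mu mphi.
pose nu := mscale (NngNum (ltW k0)) nu0.
have nuE A : measurable A -> mu A = nu A.
  apply: lebesgue_measure_unique => X [[a b] /= ab <-].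
  rewrite /nu /mscale /= /pushforward.
  have -> : phi @^-1` `]a, b]%classic = `](a / k + c), (b / k + c)]%classic.
    apply/seteqP; split => x /=; rewrite !in_itv/= /phi.
      by rewrite -ltrBrDr -lerBlDr ltr_pdivrMr// ler_pdivlMr// mulrC.
    by rewrite -ltrBrDr -lerBlDr ltr_pdivrMr// ler_pdivlMr// mulrC.
  rewrite !lebesgue_measure_itv/= !lte_fin ltrD2r ltr_pM2r ?invr_gt0//.
  case: ifP; last by rewrite mule0.
  rewrite -!EFinD -EFinM => _; congr EFin; field; exact: lt0r_neq0.
rewrite (eq_measure_integral nu) => [|A mA _]; last exact: nuE.
rewrite ge0_integral_mscale//=; congr (_ * _)%E.
by rewrite ge0_integral_pushforward// preimage_setT.
Qed.

End Affine.

Section Volume.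
Local Open Scope classical_set_scope.
Context {R : realType}.
Notation mu := (@lebesgue_measure R).

Definition tuple_col n (t : n.-tuple R) : 'cV[R]_n := \col_(i < n) tnth t i.

Lemma tuple_col_cons n (x : R) (t : n.-tuple R) :
  tuple_col n.+1 (tcons (x, t)) = col_mx x%:M (tuple_col n t) :> 'cV_(1 + n).
Proof.
apply/colP => i; have [j ->|j ->] := split_ordP i.
  rewrite col_mxEu !mxE [j]ord1 eqxx mulr1n (_ : lshift n 0 = ord0)//.
  exact/val_inj.
by rewrite col_mxEd !mxE (_ : rshift 1 j = lift ord0 j) ?tnthS//; exact/val_inj.
Qed.

(** Cavalieri's principle, which unfolds from the product measure: it is defined as the integral of
    the measures of the sections. *)
Lemma volume_sections n (A : set 'cV[R]_(1 + n)) :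
  volume (A : set 'cV[R]_n.+1)
  = (\int[mu]_x volume [set y | A (col_mx x%:M y)])%E.
Proof.
apply: eq_integral => x _; rewrite /volume /=; congr (power_measure _ _ _).
apply/seteqP; split => t /=.
  by rewrite /xsection/= inE/= -/(tuple_col n.+1 _) tuple_col_cons.
by move=> h; rewrite /xsection/= inE/= -/(tuple_col n.+1 _) tuple_col_cons.
Qed.

End Volume.

(** * Balls and sublevel sets of quadratic forms *)

Section Ball.
Local Open Scope classical_set_scope.
Context {R : realType}.
Notation mu := (@lebesgue_measure R).

(** The parameter is the squared radius, so that sections are again of this shape; a negative value
    gives the empty set. *)
Definition sqball n (t : R) : set 'cV[R]_n := [set x | dot x x <= t].

Lemma volume_ge0 n (A : set 'cV[R]_n) : (0 <= volume A)%E.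
Proof. exact: measure_ge0. Qed.

Lemma measurable_sqball n t :
  measurable [set u : n.-tuple R | sqball n t (tuple_col n u)].
Proof.
have mf : measurable_fun setT
    (fun u : n.-tuple R => dot (tuple_col n u) (tuple_col n u)).
  apply: measurable_sum => i /=.
  have -> : (fun u : n.-tuple R => tuple_col n u i 0 * tuple_col n u i 0)
      = (fun u => tnth u i * tnth u i) by apply/funext => u; rewrite mxE.
  by apply: measurable_funM; exact: measurable_tnth.
have := mf measurableT `]-oo, t]%classic (measurable_itv _).
by rewrite setTI.
Qed.

Lemma sqball_section n (t x : R) :
  [set y | sqball (1 + n) t (col_mx x%:M y)] = sqball n (t - x ^+ 2).
Proof.
apply/seteqP; split => y; rewrite /sqball /= dot_col_mx;
  by rewrite dot_scalar [x ^+ 2 + _]addrC -lerBrDr.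
Qed.

Lemma measurable_volume_sqball n t :
  measurable_fun [set: R] (fun x => volume (sqball n (t - x ^+ 2))).
Proof.
have mA : measurable (@tcons _ R n @^-1`
    [set u : n.+1.-tuple R | sqball n.+1 t (tuple_col n.+1 u)]).
  rewrite -[X in measurable X]setTI; apply: measurable_tcons => //.
  exact: measurable_sqball.
have := measurable_fun_xsection (power_measure mu n) mA.
congr measurable_fun; apply/funext => x /=.
rewrite -sqball_section /volume; congr (power_measure _ _ _).
apply/seteqP; split => u /=; rewrite /xsection/= inE/= tuple_col_cons//.
Qed.

Lemma volume_sqballS n t :
  volume (sqball n.+1 t) = (\int[mu]_x volume (sqball n (t - x ^+ 2)))%E.
Proof.
by rewrite volume_sections; apply: eq_integral => x _; rewrite sqball_section.
Qed.

(* The sections x_1 = const of an ellipsoid are translated level sets of one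
   form Y in one dimension less, by completing the square. *)
Lemma volume_level_set n (X : 'M[R]_n) c t : symposdef X ->
  volume [set x | dot (X *m (x - c)) (x - c) <= t]
  = (volume (sqball n t) * ((Num.sqrt (\det X))^-1)%:E)%E.
Proof.
elim: n X c t => [|n IH].
  move=> X c t _; rewrite det_mx00 sqrtr1 invr1 mule1; congr volume.
  by apply/seteqP; split => x; rewrite /sqball/= /dot !big_ord0.
rewrite -add1n => X c t hX.
have [s [w [Y [s0 hY XE]]]] := schur_complement n X hX.
have [dY _ _ _] := hadamard n Y hY.
have detX : \det X = s * \det Y by rewrite XE; exact: det_schur.
rewrite volume_sections -[X in volume (sqball X t)]/n.+1 volume_sqballS.
pose k := Num.sqrt s; have k0 : 0 < k by rewrite sqrtr_gt0.
pose c0 := c (lshift n 0) 0.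
(* The section is a level set of [Y] at level [t - s * (x - c0) ^+ 2], with a center that moves
   linearly in [x]; the factor [k = sqrt s] is removed afterwards by an affine substitution. *)
have sec x : volume [set y | dot (X *m (col_mx x%:M y - c)) (col_mx x%:M y - c) <= t]
    = (volume (sqball n (t - (k * (x - c0)) ^+ 2)) * ((Num.sqrt (\det Y))^-1)%:E)%E.
  rewrite -(IH Y (dsubmx c - (x - c0) *: w))//; congr volume.
  have cE : c = col_mx c0%:M (dsubmx c).
    rewrite -[LHS]vsubmxK; congr col_mx; rewrite [LHS]mx11_scalar; congr _%:M.
    by rewrite mxE.
  have zE y : col_mx x%:M y - c = col_mx (x - c0)%:M (y - dsubmx c).
    by rewrite {1}cE opp_col_mx add_col_mx -raddfB.
  apply/seteqP; split => y /=; rewrite zE XE schur_complement_dot//;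
    rewrite exprMn sqr_sqrtr ?(ltW s0)// [s * _ + _]addrC -lerBrDr;
    by rewrite opprB addrA addrAC.
under eq_integral do rewrite sec.
have mV : measurable_fun [set: R]
    (fun x => volume (sqball n (t - (k * (x - c0)) ^+ 2))).
  apply: (measurableT_comp (measurable_volume_sqball n t)).
  exact: measurable_affine.
have V0 x : (0 <= volume (sqball n (t - x ^+ 2)))%E by exact: volume_ge0.
rewrite ge0_integralZr//.
rewrite [in RHS](ge0_integral_affine k c0)//; last exact: measurable_volume_sqball.
rewrite [in RHS]muleAC -EFinM detX sqrtrM ?(ltW s0)// invfM mulrA.
by rewrite mulfV ?mul1r ?gt_eqF// muleC.
Qed.

(** Needed to cancel the volume of the unit ball when two ellipsoids are compared. By induction: for
    [0 <= x <= sqrt (t / 2)] the sections contain a ball of level [t / 2], and all sections lie in a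
    ball of level [t] and are empty for [x] outside a bounded interval. *)
Lemma volume_sqball_gt0_fin n (t : R) : 0 < t ->
  (0 < volume (sqball n t) < +oo)%E.
Proof.
elim: n t => [|n IH] t t0.
  rewrite /volume /= diracE mem_set ?lte01 ?ltry//=.
  by rewrite /sqball/= /dot big_ord0 ltW.
have mf := measurable_volume_sqball n t.
have f0 x : (0 <= volume (sqball n (t - x ^+ 2)))%E by exact: volume_ge0.
have mono (a b : R) : a <= b -> (volume (sqball n a) <= volume (sqball n b))%E.
  move=> ab; apply: le_measure; rewrite ?inE; try exact: measurable_sqball.
  by move=> u; rewrite /sqball /= => /le_trans; apply.
rewrite volume_sqballS; apply/andP; split.
  pose T := Num.sqrt (t / 2).
  have T0 : 0 < T by rewrite sqrtr_gt0 divr_gt0.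
  have mI : measurable (`[0, T]%classic : set R) by exact: measurable_itv.
  have lower : (0 < \int[mu]_(x in `[0%R, T]) volume (sqball n (t / 2)))%E.
    have -> := integral_cst mu mI (volume (sqball n (t / 2))).
    rewrite /= lebesgue_measure_itv/= lte_fin T0 oppr0 adde0.
    have /IH/andP[V0 _] : 0 < t / 2 by rewrite divr_gt0.
    by rewrite mule_gt0// lte_fin.
  apply: (lt_le_trans lower).
  apply: (@le_trans _ _
    (\int[mu]_(x in `[0%R, T]) volume (sqball n (t - x ^+ 2)))%E).
    apply: ge0_le_integral => //.
      exact: measurable_funTS.
    move=> x /=; rewrite in_itv/= => /andP[x0 xT]; apply: mono.
    have : x ^+ 2 <= t / 2.
      rewrite -[leRHS]sqr_sqrtr ?divr_ge0 ?(ltW t0)//.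
      by rewrite ler_sqr// nnegrE ?sqrtr_ge0.
    lra.
  by apply: ge0_subset_integral.
(* Outside this interval [x ^+ 2] exceeds [t], since [(1 + t) ^+ 2 > t]. *)
pose I := `[- (1 + t), 1 + t]%classic : set R.
have mI : measurable I by exact: measurable_itv.
rewrite (_ : (\int[mu]_x _)%E
    = (\int[mu]_(x in I) volume (sqball n (t - x ^+ 2)))%E); last first.
  rewrite [RHS]integral_mkcond; apply: eq_integral => x _.
  rewrite patchE; case: ifPn => // xI; rewrite (_ : sqball n _ = set0).
    exact: measure0.
  rewrite -subset0 => y; rewrite /sqball/= => /(le_trans (dot_ge0 _ _)).
  rewrite leNgt => /negP; apply; move/negP: xI; rewrite inE /I/= in_itv/=.
  move=> /negP; rewrite negb_and -!ltNge => /orP[]; nra.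
apply: (@le_lt_trans _ _ (\int[mu]_(x in I) volume (sqball n t))%E).
  apply: ge0_le_integral => //.
    exact: measurable_funTS.
  by move=> x _; apply: mono; rewrite gerBl sqr_ge0.
have -> := integral_cst mu mI (volume (sqball n t)).
rewrite /= lebesgue_measure_itv/= lte_mul_pinfty//.
- by rewrite ge0_fin_numE ?volume_ge0//; case/andP: (IH t t0).
- by case: ifP => // _; rewrite -EFinD ltry.
Qed.

End Ball.

(** * Contact points *)

Section Certificate.
Local Open Scope classical_set_scope.
Context {R : realType} (m : nat).
Local Notation n := m.+1.
Implicit Types (X : 'M[R]_n) (c x y : 'cV[R]_n).

Lemma dot_delta (i j : 'I_n) :
  dot (delta_mx i 0) (delta_mx j 0) = (i == j)%:R :> R.
Proof.
rewrite dotE trmx_delta mul_delta_mx_cond mulrb.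
by case: (i == j); rewrite mxE.
Qed.

Lemma dot_mul_delta X (i : 'I_n) :
  dot (X *m delta_mx i 0) (delta_mx i 0) = X i i.
Proof. by rewrite dotC dotE trmx_delta -rowE -colE !mxE. Qed.

Lemma e1E : e1 R n = delta_mx ord0 0.
Proof. by apply/colP => i; rewrite !mxE eqxx andbT. Qed.

Lemma circle_in_Bab (al be ga s : R) (j : 'I_m) :
  al <= ga <= be -> ga ^+ 2 <= 1 -> s ^+ 2 = 1 - ga ^+ 2 ->
  Bab n al be (ga *: delta_mx ord0 0 + s *: delta_mx (lift ord0 j) 0).
Proof.
move=> hga ga1 hs; split.
  rewrite /enorm dotDl !dotDr !dotZl !dotZr !dot_delta !eqxx.
  rewrite (negbTE (neq_lift _ _)) eq_sym (negbTE (neq_lift _ _)).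
  rewrite !mulr0 !mulr1 addr0 add0r -!expr2 hs addrC subrK.
  by rewrite sqrtr1.
move=> i i0; have {i0} -> : i = ord0 by exact/val_inj.
by rewrite !mxE eqxx mulr1 mulr0 addr0.
Qed.

Lemma parallelogram X x y :
  dot (X *m (x + y)) (x + y) + dot (X *m (x - y)) (x - y)
  = 2 * (dot (X *m x) x + dot (X *m y) y).
Proof.
rewrite -[- y]scaleN1r !mulmxDr -!scalemxAr !(dotDl, dotDr, dotZl, dotZr).
ring.
Qed.

(** A two-point average with mean zero kills the terms linear in the step, and its variance is
    [u * s ^+ 2 + v * t ^+ 2 = - s * t]. *)
Lemma segment_dot X x y (u v s t : R) : u + v = 1 -> u * s + v * t = 0 ->
  u * dot (X *m (x + s *: y)) (x + s *: y)
  + v * dot (X *m (x + t *: y)) (x + t *: y)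
  = dot (X *m x) x - s * t * dot (X *m y) y.
Proof.
move=> uv1 ust0; rewrite !mulmxDr -!scalemxAr !(dotDl, dotDr, dotZl, dotZr).
set A := dot _ _; set B := dot _ _; set C := dot _ _; set D := dot _ _.
have v1 : v = 1 - u by rewrite -uv1; ring.
have : (u * s + v * t) * (B + C + (s + t) * D) = 0 by rewrite ust0 mul0r.
rewrite v1 => e; rewrite -[RHS]addr0 -e; ring.
Qed.

(** For each [j] the two points with opposite signs are averaged by the parallelogram law, which
    removes the cross term; then one averages over [j]. *)
Lemma circle_average (al be ga : R) X c : (0 < m)%N ->
  Bab n al be `<=` E X c -> al <= ga <= be -> ga ^+ 2 <= 1 ->
  dot (X *m (ga *: delta_mx ord0 0 - c)) (ga *: delta_mx ord0 0 - c)
  + (1 - ga ^+ 2) / m%:R * \sum_(j < m) X (lift ord0 j) (lift ord0 j) <= 1.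
Proof.
move=> m0 hB hga ga1; set q := dot _ _.
pose r := Num.sqrt (1 - ga ^+ 2).
have r2 : r ^+ 2 = 1 - ga ^+ 2 by rewrite sqr_sqrtr// subr_ge0.
have key (j : 'I_m) : q + (1 - ga ^+ 2) * X (lift ord0 j) (lift ord0 j) <= 1.
  have h1 := hB _ (circle_in_Bab al be ga r j hga ga1 r2).
  have := hB _ (circle_in_Bab al be ga (- r) j hga ga1 _).
  rewrite sqrrN => /(_ r2) h2; move: h1 h2; rewrite /E /=.
  rewrite scaleNr ![_ *: _ + _ - c]addrAC => h1 h2.
  have := parallelogram X (ga *: delta_mx ord0 0 - c)
    (r *: delta_mx (lift ord0 j) 0).
  rewrite -scalemxAr dotZl dotZr mulrA -expr2 r2 dot_mul_delta -/q; lra.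
have mR : 0 < m%:R :> R by rewrite ltr0n.
rewrite -(ler_pM2l mR) mulr1 mulrDr mulrA [_ * (_ / _)]mulrC divfK ?gt_eqF//.
set S := \sum_(j < m) _.
have : \sum_(j < m) (q + (1 - ga ^+ 2) * X (lift ord0 j) (lift ord0 j))
    <= \sum_(j < m) 1 by apply: ler_sum => j _.
by rewrite big_split/= !sumr_const card_ord -mulr_sumr mulr_natl.
Qed.

Lemma contact_inequality (al be tau : R) X c : (0 < m)%N ->
  -1 <= al -> al < be -> be <= 1 -> al <= tau <= be ->
  Bab n al be `<=` E X c ->
  dot (X *m (tau *: delta_mx ord0 0 - c)) (tau *: delta_mx ord0 0 - c)
  + (be - tau) * (tau - al) * X ord0 ord0
  + (1 - (al + be) * tau + al * be) / m%:R
    * \sum_(j < m) X (lift ord0 j) (lift ord0 j) <= 1.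
Proof.
move=> m0 al1 ab be1 /andP[at_ tb] hB.
set S := \sum_(j < m) _.
have hal := circle_average al be al X c m0 hB.
have hbe := circle_average al be be X c m0 hB.
have {}hal := hal ltac:(lra) ltac:(nra); have {}hbe := hbe ltac:(lra) ltac:(nra).
rewrite -/S in hal hbe.
have d0 : 0 < be - al by lra.
(* The weights on [al] and [be] whose mean is [tau]; their variance is [(be - tau) * (tau - al)]. *)
pose u := (be - tau) / (be - al); pose v := (tau - al) / (be - al).
have u0 : 0 <= u by apply: divr_ge0; lra.
have v0 : 0 <= v by apply: divr_ge0; lra.
have uv : u + v = 1 by rewrite /u /v; field; lra.
have ust : u * (al - tau) + v * (be - tau) = 0 by rewrite /u /v; field; lra.
have := segment_dot X (tau *: delta_mx ord0 0 - c) (delta_mx ord0 0) u v _ _ uv ust.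
rewrite dot_mul_delta ![_ - c + _]addrAC -!scalerDl !subrKC => e.
have := lerD (ler_wpM2l u0 hal) (ler_wpM2l v0 hbe).
rewrite !mulr1 uv !mulrDr addrACA e.
have -> : u * ((1 - al ^+ 2) / m%:R * S) + v * ((1 - be ^+ 2) / m%:R * S)
  = ((1 - (al + be) * tau + al * be) / m%:R * S).
  rewrite !mulrA -!mulrDl; do 2 congr (_ * _).
  by rewrite /u /v; field; lra.
by apply: le_trans; rewrite lerD2r lerD2l; nra.
Qed.

End Certificate.

(** * The determinant bound and covering by feasible points *)

Section Extremal.
Local Open Scope classical_set_scope.
Context {R : realType} (m : nat).
Local Notation n := m.+1.
Implicit Types (X : 'M[R]_n) (c x y : 'cV[R]_n).

Lemma diag1_ord0 (a b : R) : diag1 n a b ord0 ord0 = a.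
Proof. by rewrite !mxE eqxx. Qed.

Lemma diag1_lift (a b : R) (j : 'I_m) :
  diag1 n a b (lift ord0 j) (lift ord0 j) = b.
Proof. by rewrite !mxE eqxx. Qed.

Lemma det_diag1 (a b : R) : \det (diag1 n a b) = a * b ^+ m.
Proof.
rewrite det_diag big_ord_recl mxE/=; congr (_ * _).
rewrite -[m in RHS]card_ord -prodr_const; apply: eq_bigr => i _.
by rewrite mxE.
Qed.

Lemma dot_diag1 (a b : R) x :
  dot (diag1 n a b *m x) x = a * x ord0 0 ^+ 2 + b * (dot x x - x ord0 0 ^+ 2).
Proof.
rewrite /dot !big_ord_recl mul_diag_mx !mxE/= !expr2 mulrA; congr (_ + _).
rewrite addrC addKr mulr_sumr.
by apply: eq_bigr => i _; rewrite !mxE/= mulrA.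
Qed.

Lemma symposdef_diag1 (a b : R) : 0 < a -> 0 < b -> symposdef (diag1 n a b).
Proof.
move=> a0 b0; split; first by rewrite tr_diag_mx.
move=> x; rewrite -dot_eq0 => x0.
have {}x0 : 0 < dot x x by rewrite lt_def x0 dot_ge0.
rewrite dot_diag1; have h : x ord0 0 ^+ 2 <= dot x x.
  by rewrite /dot big_ord_recl expr2 lerDl sumr_ge0// => i _; exact: sqr_ge0.
have [e|ne] := eqVneq (x ord0 0 ^+ 2) 0.
  by rewrite e mulr0 add0r subr0 mulr_gt0.
apply: ltr_pwDl; first by rewrite mulr_gt0// lt_def ne sqr_ge0.
by rewrite mulr_ge0 ?subr_ge0// ltW.
Qed.

(** AM-GM for the ratios of the diagonal of [X] to that of [diag1 n a b]: their mean is at most 1,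
    hence so is their product, and a product equal to 1 makes every ratio 1. *)
Lemma diag_prod_le (a b : R) X : 0 < a -> 0 < b -> (forall i, 0 < X i i) ->
  X ord0 ord0 / a + \sum_(j < m) X (lift ord0 j) (lift ord0 j) / b <= n%:R ->
  \prod_i X i i <= a * b ^+ m /\
  (\prod_i X i i = a * b ^+ m ->
   X ord0 ord0 = a /\ forall j, X (lift ord0 j) (lift ord0 j) = b).
Proof.
move=> a0 b0 X0 hS; set D := diag1 n a b.
have D0 i : 0 < D i i.
  by have [j ->|->] := unliftP ord0 i; rewrite ?diag1_lift ?diag1_ord0.
pose F i := X i i / D i i.
have F0 i : 0 <= F i by apply/ltW/divr_gt0.
have prodF : \prod_i F i = \prod_i X i i / (a * b ^+ m).
  rewrite big_split/= prodfV; congr (_ / _).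
  rewrite big_ord_recl diag1_ord0 (eq_bigr _ (fun j _ => diag1_lift a b j)).
  by rewrite prodr_const card_ord.
have sumF : \sum_i F i <= n%:R.
  rewrite big_ord_recl /F diag1_ord0.
  by under eq_bigr do rewrite diag1_lift.
have n0 : 0 < n%:R :> R by rewrite ltr0n.
have [leP AGM_eq] := @leif_AGM _ _ [pred i : 'I_n | true] F (fun i _ => F0 i).
rewrite card_ord/= in leP AGM_eq.
have mean1 : ((\sum_i F i) / n%:R) ^+ n <= 1.
  apply: exprn_ile1; last by rewrite ler_pdivrMr// mul1r.
  by rewrite divr_ge0 ?sumr_ge0.
have P0 : 0 < a * b ^+ m by rewrite mulr_gt0// exprn_gt0.
split; first by rewrite -[leRHS]mul1r -ler_pdivrMr// -prodF (le_trans leP).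
move=> e; have prod1 : \prod_i F i = 1 by rewrite prodF e divff// gt_eqF.
have : \prod_i F i == ((\sum_i F i) / n%:R) ^+ n.
  by rewrite eq_le leP prod1 mean1.
rewrite AGM_eq => /forallP h.
have cF i : F i = F ord0 by have /forallP/(_ ord0)/eqP := h i.
have F1 : F ord0 = 1.
  move: prod1; rewrite (eq_bigr _ (fun i _ => cF i)) prodr_const card_ord.
  by move/eqP; rewrite pexpr_eq1// => /eqP.
have XD i : X i i = D i i.
  by have := cF i; rewrite F1 => /divr1_eq.
by split=> [|j]; rewrite XD ?diag1_ord0 ?diag1_lift.
Qed.

(** The two equations on [a] and [b] turn the coefficients of the contact inequality into
    [1 / (n a)] and [1 / (n b)], which is the form that AM-GM requires. *)
Lemma det_le_of_cover (al be tau a b : R) X c : (0 < m)%N ->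
  -1 <= al -> al < be -> be <= 1 -> al <= tau <= be -> 0 < a -> 0 < b ->
  n%:R * (be - tau) * (tau - al) * a = 1 ->
  n%:R * (1 - (al + be) * tau + al * be) * b = m%:R ->
  symposdef X -> Bab n al be `<=` E X c ->
  \det X <= a * b ^+ m /\
  (\det X = a * b ^+ m -> X = diag1 n a b /\ c = tau *: e1 R n).
Proof.
move=> m0 al1 ab be1 htau a0 b0 ha hb hX hB.
have := contact_inequality m al be tau X c m0 al1 ab be1 htau hB.
have q0 := symposdef_ge0 _ _ (tau *: delta_mx ord0 0 - c) hX.
set q := dot _ _ in q0 *; set S := \sum_(j < m) _ => h.
have n0 : 0 < n%:R :> R by rewrite ltr0n.
have m0R : 0 < m%:R :> R by rewrite ltr0n.
have e1 : (be - tau) * (tau - al) = (n%:R * a)^-1.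
  by apply: (mulIf (lt0r_neq0 (mulr_gt0 n0 a0)));
    rewrite mulVf ?gt_eqF ?mulr_gt0// -[RHS]ha; ring.
have e2 : (1 - (al + be) * tau + al * be) / m%:R = (n%:R * b)^-1.
  apply: (mulIf (lt0r_neq0 (mulr_gt0 n0 b0))).
  rewrite mulVf ?gt_eqF ?mulr_gt0// mulrAC; apply: (canLR (mulfK _)).
    by rewrite gt_eqF.
  by rewrite mul1r -[RHS]hb; ring.
rewrite e1 e2 in h.
have {}h : n%:R * q + (X ord0 ord0 / a
    + \sum_(j < m) X (lift ord0 j) (lift ord0 j) / b) <= n%:R.
  rewrite -mulr_suml -/S -[leRHS]mulr1; apply: le_trans (ler_wpM2l (ltW n0) h).
  by rewrite le_eqVlt; apply/orP; left; apply/eqP; field; rewrite !gt_eqF.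
have [dX dgX leX eqX] := hadamard n X hX.
have sum_le : X ord0 ord0 / a
    + \sum_(j < m) X (lift ord0 j) (lift ord0 j) / b <= n%:R.
  by apply: le_trans h; rewrite lerDr mulr_ge0// ltW.
have [leP prod_eq] := diag_prod_le a b X a0 b0 dgX sum_le.
split; first exact: le_trans leX leP.
move=> e; have eP : \prod_i X i i = a * b ^+ m.
  by apply/eqP; rewrite eq_le leP -e leX.
have [X00 Xjj] := prod_eq eP.
split.
  apply/matrixP => i j; have [->|ij] := eqVneq i j.
    by have [k ->|->] := unliftP ord0 j; rewrite ?diag1_lift ?diag1_ord0.
  by rewrite eqX ?e ?eP// mxE (negbTE ij).
(* The diagonal terms already sum to [n], which leaves no room for [q], and so the center is
   determined. *)
have q1 : q <= 0.
  move: h; under eq_bigr do rewrite Xjj divff ?gt_eqF//.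
  rewrite X00 divff ?gt_eqF// sumr_const card_ord -[1 + _]mulrS.
  by rewrite gerDr pmulr_rle0.
by apply/esym/subr0_eq; rewrite e1E; exact: symposdef_eq0 hX q1.
Qed.

(** By the two equality constraints the form at a point [x] with first coordinate [z] equals [1 - (a
    - b) * (z - al) * (be - z) - b * (1 - dot x x)], and both subtracted terms are nonnegative on
    the body. *)
Lemma feasible_cover (al be a b tau : R) : nlp_feasible al be a b tau ->
  Bab n al be `<=` E (diag1 n a b) (tau *: e1 R n).
Proof.
move=> [a0 b0 h1 h2 ba] x [hx /(_ ord0 erefl) /andP[x1 x2]].
rewrite /E /= dot_diag1 e1E.
have dx : dot x x <= 1.
  by move: hx; rewrite /enorm -[X in _ <= X]sqrtr1 ler_psqrt ?nnegrE ?dot_ge0.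
set y := x - _.
have y0 : y ord0 0 = x ord0 0 - tau by rewrite !mxE !eqxx mulr1.
have yy : dot y y - y ord0 0 ^+ 2 = dot x x - x ord0 0 ^+ 2.
  rewrite /dot !big_ord_recl -!expr2 ![_ ^+ 2 + _]addrC !addrK.
  by apply: eq_bigr => i _; rewrite !mxE/= mulr0 subr0.
rewrite yy y0; set z := x ord0 0 in x1 x2 *.
have : 0 <= (a - b) * ((z - al) * (be - z)).
  by apply: mulr_ge0; [lra|apply: mulr_ge0; lra].
have : b * dot x x <= b by rewrite ger_pMr.
have : (a * tau - (al + be) / 2 * (a - b)) * z = 0 by rewrite h1 mul0r.
move: h2; set D := dot x x; set p := a * tau ^+ 2.
have -> : a * (z - tau) ^+ 2 = a * z ^+ 2 - 2 * (a * tau * z) + p.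
  by rewrite /p; ring.
lra.
Qed.

End Extremal.

(** * Optimality *)

Section Optimum.
Local Open Scope classical_set_scope.
Context {R : realType} (m : nat).
Local Notation n := m.+1.

Lemma volume_E_le (X Y : 'M[R]_n) c d : symposdef X -> symposdef Y ->
  (volume (E X c) <= volume (E Y d))%E = (\det Y <= \det X).
Proof.
move=> hX hY; rewrite /E !volume_level_set//.
have /andP[V0 Voo] := volume_sqball_gt0_fin n (1 : R) ltr01.
have [dX _ _ _] := hadamard n X hX; have [dY _ _ _] := hadamard n Y hY.
rewrite lee_pmul2l// ?ge0_fin_numE ?(ltW V0)// lee_fin lef_pV2 ?posrE ?sqrtr_gt0//.
by rewrite ler_psqrt// nnegrE ltW.
Qed.

(** The certificate shared by both problems: it determines the optimal solution of the program as
    well as the minimal ellipsoid. *)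
Definition extremal_triple (al be a b tau : R) : Prop :=
  nlp_feasible al be a b tau /\
  forall (X : 'M[R]_n) c, symposdef X -> Bab n al be `<=` E X c ->
    \det X <= a * b ^+ m /\
    (\det X = a * b ^+ m -> X = diag1 n a b /\ c = tau *: e1 R n).

Lemma diag1_inj (a b tau a' b' tau' : R) : (0 < m)%N ->
  diag1 n a b = diag1 n a' b' -> tau *: e1 R n = tau' *: e1 R n ->
  [/\ a = a', b = b' & tau = tau'].
Proof.
move=> m0 hD hc; split.
- by rewrite -(diag1_ord0 m a b) hD diag1_ord0.
- by rewrite -(diag1_lift m a b (Ordinal m0)) hD diag1_lift.
- by move/colP/(_ ord0): hc; rewrite !mxE/= !mulr1.
Qed.

Lemma nlp_objective_ln (a b : R) : 0 < a -> 0 < b ->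
  nlp_objective n a b = - ln (a * b ^+ m).
Proof.
move=> a0 b0; rewrite /nlp_objective lnM ?posrE ?exprn_gt0// lnXn//.
by rewrite opprD -[n%:R]natr1 addrK mulr_natl.
Qed.

(** A feasible point is a covering ellipsoid and the objective is minus the logarithm of its
    determinant, so the determinant bound and its equality case apply directly. *)
Lemma nlp_optimalP (al be a0 b0 tau0 : R) : (0 < m)%N ->
  extremal_triple al be a0 b0 tau0 -> forall a b tau,
  nlp_optimal n al be a b tau <-> [/\ tau = tau0, a = a0 & b = b0].
Proof.
move=> m0 [hf hext].
have obj a b tau : nlp_feasible al be a b tau ->
    a * b ^+ m <= a0 * b0 ^+ m /\
    (a * b ^+ m = a0 * b0 ^+ m -> [/\ a = a0, b = b0 & tau = tau0]).
  move=> h; have [a1 b1 _ _ _] := h.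
  have [] := hext _ _ (symposdef_diag1 m a b a1 b1) (feasible_cover m _ _ _ _ _ h).
  by rewrite det_diag1 => le eq; split => // /eq[]; exact: diag1_inj.
have [a00 b00 _ _ _] := hf.
have P0 : 0 < a0 * b0 ^+ m by rewrite mulr_gt0// exprn_gt0.
move=> a b tau; split.
  move=> [h opt]; have [le eq] := obj _ _ _ h; have [a1 b1 _ _ _] := h.
  have P1 : 0 < a * b ^+ m by rewrite mulr_gt0// exprn_gt0.
  have := opt _ _ _ hf; rewrite !nlp_objective_ln// lerN2 ler_ln ?posrE// => ge.
  by have [] : [/\ a = a0, b = b0 & tau = tau0] by apply: eq; apply/le_anti/andP.
move=> [-> -> ->]; split => // a' b' tau' h; have [a1 b1 _ _ _] := h.
rewrite !nlp_objective_ln// lerN2 ler_ln ?posrE ?mulr_gt0 ?exprn_gt0//.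
by have [] := obj _ _ _ h.
Qed.

(** Volume order is reversed determinant order, so the equality case of the bound gives a unique
    minimizer; its parameters are then recovered by applying uniqueness to the matrix and center
    themselves. *)
Lemma CE_P (al be a0 b0 tau0 : R) : (0 < m)%N ->
  extremal_triple al be a0 b0 tau0 -> forall a b tau, 0 < a -> 0 < b ->
  CE (Bab n al be) = E (diag1 n a b) (tau *: e1 R n) <->
  [/\ tau = tau0, a = a0 & b = b0].
Proof.
move=> m0 [hf hext]; have [a00 b00 _ _ _] := hf.
have pD := symposdef_diag1 m a0 b0 a00 b00.
set S0 := E (diag1 n a0 b0) (tau0 *: e1 R n).
have cov := feasible_cover m _ _ _ _ _ hf : _ `<=` S0.
have uniq X c : symposdef X -> Bab n al be `<=` E X c ->
    (volume (E X c) <= volume S0)%E ->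
    X = diag1 n a0 b0 /\ c = tau0 *: e1 R n.
  move=> hX hB; rewrite volume_E_le// det_diag1 => ge.
  by have [le] := hext X c hX hB; apply; apply/le_anti/andP.
have minS0 : min_volume_covering (Bab n al be) S0.
  split => //; first by exists (diag1 n a0 b0), (tau0 *: e1 R n).
  move=> _ [X [c [hX ->]]] hB; rewrite volume_E_le// det_diag1.
  by have [] := hext X c hX hB.
have CE0 : CE (Bab n al be) = S0.
  apply: xget_unique; first split => // S' [[X [c [hX ->]]] hB hmin].
    have [|-> ->//] := uniq X c hX hB.
    by case: minS0 => e0 c0 _; exact: hmin.
  by move=> S' [hS' /(_ _ minS0)].
move=> a b tau a1 b1; rewrite CE0; split=> [e|[-> -> ->]//].
have [||eD ec] := uniq _ (tau *: e1 R n) (symposdef_diag1 m a b a1 b1).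
- by rewrite -e.
- by rewrite -e.
by have [] := diag1_inj _ _ _ _ _ _ m0 eD ec.
Qed.

End Optimum.

(** * Extremal triples in the three cases *)

Section Cases.
Local Open Scope classical_set_scope.
Context {R : realType} (m : nat).
Local Notation n := m.+1.

Lemma extremal_triple_ball (al be : R) : (0 < m)%N ->
  -1 <= al -> al < be -> be <= 1 -> 0 <= al + be -> al * be <= - (1 / n%:R) ->
  extremal_triple m al be 1 1 0.
Proof.
move=> m0 al1 ab be1 s_ge0 h.
have n0 : 0 < n%:R :> R by rewrite ltr0n.
have n2 : 2 <= n%:R :> R by rewrite ler_nat.
have mn : m%:R = n%:R - 1 :> R by rewrite -[n%:R]natr1 addrK.
have be0 : 0 < be by lra.
have hn : n%:R * (al * be) <= - 1.
  by rewrite mulrC -ler_pdivlMr// mulNr.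
have al0 : al < 0.
  by rewrite -(pmulr_llt0 _ be0) (le_lt_trans h)// oppr_lt0 divr_gt0.
have nal0 : n%:R * al < 0 by rewrite pmulr_rlt0.
split; first by split; lra.
(* Some contact points of the unit sphere suffice: those with x_1 = al and
   x_1 = ga, chosen so that n al ga = -1. *)
pose ga := - (n%:R * al)^-1.
have ga_al : n%:R * ga * al = -1 by rewrite /ga; field; lra.
have ga0 : 0 < ga by rewrite oppr_gt0 invr_lt0.
have ga_be : ga <= be.
  rewrite -(ler_nM2l nal0); lra.
move=> X c hX hB; apply: (@det_le_of_cover R m al ga) => //; try lra.
(* Since [ga <= be], an ellipsoid covering the given body also covers the thinner slab section with
   bounds [al] and [ga]. *)
move=> x [hx1 hx2]; apply: hB; split => // i i0; have := hx2 i i0; lra.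
Qed.

Lemma extremal_triple_symmetric (al be : R) : (0 < m)%N ->
  -1 <= al -> al < be -> be <= 1 -> al + be = 0 -> - (1 / n%:R) < al * be ->
  extremal_triple m al be (1 / (n%:R * be ^+ 2))
    ((n%:R - 1) / (n%:R * (1 - be ^+ 2))) 0.
Proof.
move=> m0 al1 ab be1 s0 h.
have n0 : 0 < n%:R :> R by rewrite ltr0n.
have n2 : 2 <= n%:R :> R by rewrite ler_nat.
have mn : m%:R = n%:R - 1 :> R by rewrite -[n%:R]natr1 addrK.
have be0 : 0 < be by lra.
have hn : -1 < n%:R * (al * be).
  by rewrite mulrC -ltr_pdivrMr// mulNr.
have alE : al = - be by lra.
(* This is the case hypothesis, and it is what yields the constraint [b <= a]. *)
have be2 : n%:R * be ^+ 2 < 1 by rewrite alE in hn; nra.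
have be21 : 0 < 1 - be ^+ 2 by nra.
have be20 : 0 < be ^+ 2 by rewrite exprn_gt0.
set a := 1 / _; set b := _ / _.
have a0 : 0 < a by rewrite divr_gt0// mulr_gt0.
have b0 : 0 < b by rewrite divr_gt0 ?mulr_gt0//; lra.
have ha : n%:R * be ^+ 2 * a = 1 by rewrite /a; field; rewrite !gt_eqF.
have hb : n%:R * (1 - be ^+ 2) * b = n%:R - 1 by rewrite /b; field; rewrite !gt_eqF.
split.
  split => //; first by rewrite s0; ring.
    by rewrite alE; apply: (mulfI (lt0r_neq0 n0)); lra.
  rewrite addrC subr_le0 /a /b ler_pdivrMr ?mulr_gt0//.
  rewrite mulrAC -mulrA mul1r ler_pdivlMr ?mulr_gt0//; nra.
move=> X c hX hB; apply: (@det_le_of_cover R m al be) => //; try lra.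
- by rewrite -[RHS]ha alE; ring.
- by rewrite mn -hb alE; ring.
Qed.

Lemma extremal_triple_general (al be : R)
   (Delta := n%:R ^+ 2 * (be ^+ 2 - al ^+ 2) ^+ 2
             + 4 * (1 - al ^+ 2) * (1 - be ^+ 2))
   (tau := (n%:R * (be + al) ^+ 2 + 2 * (1 + al * be) - Num.sqrt Delta)
           / (2 * (n%:R + 1) * (be + al)))
   (a := 1 / (n%:R * (tau - al) * (be - tau)))
   (b := (1 - a * (tau - al) ^+ 2) / (1 - al ^+ 2)) :
  (0 < m)%N -> -1 <= al -> al < be -> be <= 1 -> 0 <= al + be ->
  al + be != 0 -> - (1 / n%:R) < al * be -> extremal_triple m al be a b tau.
Proof.
move=> m0 al1 ab be1 s_ge0 s_neq0 h.
have n0 : 0 < n%:R :> R by rewrite ltr0n.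
have n2 : 2 <= n%:R :> R by rewrite ler_nat.
have mn : m%:R = n%:R - 1 :> R by rewrite -[n%:R]natr1 addrK.
have be0 : 0 < be by lra.
have hn : 0 < 1 + n%:R * (al * be).
  by rewrite -ltrBlDl sub0r mulrC -ltr_pdivrMr// mulNr.
pose s := al + be; pose p := al * be.
have s0 : 0 < s by rewrite lt_def s_neq0.
have al1' : 0 < 1 + al by rewrite /s in s0; lra.
have al2 : 0 < 1 - al ^+ 2 by nra.
have be2 : 0 <= 1 - be ^+ 2 by rewrite /s in s0; nra.
have p1 : s ^+ 2 <= 2 * (1 + p) by rewrite /s /p; lra.
have d0 : 0 < s ^+ 2 - 4 * p.
  by have := exprn_gt0 2 (ltac:(lra) : 0 < be - al); rewrite /s /p; lra.
pose M := n%:R * s ^+ 2 + 2 * (1 + p).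
have Delta0 : 0 <= Delta.
  rewrite /Delta; apply: addr_ge0; first by rewrite mulr_ge0 ?sqr_ge0.
  by rewrite mulr_ge0// mulr_ge0// ltW.
pose T := Num.sqrt Delta; have T0 : 0 <= T by exact: sqrtr_ge0.
(* [Delta] is the discriminant of the quadratic equation for [tau]. *)
have T2 : T ^+ 2 = M ^+ 2 - 4 * s ^+ 2 * (n%:R + 1) * (1 + n%:R * p).
  by rewrite sqr_sqrtr// /Delta /M /s /p; ring.
have s20 : 0 < s ^+ 2 by rewrite exprn_gt0.
have M0 : 0 < M by rewrite /M addr_gt0// ?mulr_gt0//; lra.
have TM : T < M.
  rewrite -ltr_sqr ?nnegrE ?(ltW M0)// T2 ltrBlDr ltrDl !mulr_gt0//; lra.
have TL : M - (n%:R + 1) * s ^+ 2 < T.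
  have [|L0] := ltP (M - (n%:R + 1) * s ^+ 2) 0; first lra.
  rewrite -ltr_sqr ?nnegrE// T2 -subr_gt0.
  rewrite (_ : _ - _ = (n%:R + 1) * s ^+ 2 * ((n%:R - 1) * (s ^+ 2 - 4 * p))).
    by rewrite !mulr_gt0//; lra.
  by rewrite /M; ring.
have den0 : 0 < 2 * (n%:R + 1) * s by rewrite !mulr_gt0//; lra.
have tauE : tau * (2 * (n%:R + 1) * s) = M - T.
  by rewrite /tau (addrC be) divfK ?gt_eqF.
have tau0 : 0 < tau by rewrite -(pmulr_lgt0 _ den0) tauE; lra.
have tau2 : 0 < s - 2 * tau.
  rewrite -(pmulr_lgt0 _ den0) mulrBl -[2 * tau * _]mulrA tauE; nra.
(* [tau] is the smaller root of the stationarity equation [quad]; the bounds [TM]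
   and [TL] on [T] place it between 0 and [s / 2]. *)
have quad : (n%:R + 1) * s * tau ^+ 2 - M * tau + s * (1 + n%:R * p) = 0.
  have c0 : 4 * (n%:R + 1) * s != 0 by rewrite gt_eqF// !mulr_gt0//; lra.
  apply: (mulfI c0); rewrite mulr0.
  have TE : T = M - tau * (2 * (n%:R + 1) * s) by rewrite tauE; ring.
  by move: T2; rewrite TE; lra.
pose q := n%:R * (tau - al) * (be - tau).
have sq_ : s * q = s + s * tau ^+ 2 - 2 * (1 + p) * tau.
  move: quad; rewrite /q /M /s /p; lra.
have q0 : 0 < q.
  rewrite -(pmulr_rgt0 _ s0) sq_.
  (* Four times the right side of [sq_] is this product plus [s * (s ^+ 2 - 4 * p)], the latter
     being four times its value at [tau = s / 2]. *)
  have : 0 <= (s - 2 * tau) * (4 * (1 + p) - s * (2 * tau + s)).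
    by apply: mulr_ge0; nra.
  have : 0 < s * (s ^+ 2 - 4 * p) by rewrite mulr_gt0.
  lra.
have tau_in : al < tau < be.
  move: q0; rewrite /q -mulrA pmulr_rgt0// => h1; apply/andP; split; nra.
have /andP[tau_al tau_be] := tau_in.
have aE : a * q = 1 by rewrite /a mul1r mulVf// gt_eqF.
have a0 : 0 < a by rewrite /a mul1r invr_gt0.
have asq : a * (s + s * tau ^+ 2 - 2 * (1 + p) * tau) = s.
  by rewrite -sq_ mulrCA aE mulr1.
(* This is the first constraint of the program. The definition of [b] says that the points of the
   unit sphere with first coordinate [al] lie on the boundary of the ellipsoid. *)
have bE : s * b = a * (s - 2 * tau).
  apply: (mulfI (lt0r_neq0 al2)).
  have -> : (1 - al ^+ 2) * (s * b) = s * (a * q) - s * a * (tau - al) ^+ 2.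
    by rewrite aE /b; field; rewrite gt_eqF.
  by rewrite mulrCA sq_ /s /p; ring.
have b0 : 0 < b by rewrite -(pmulr_rgt0 _ s0) bE mulr_gt0.
split.
  split => //.
  - apply: (mulfI (lt0r_neq0 s0)); rewrite mulr0 -/s.
    have -> : s * (a * tau - s / 2 * (a - b))
      = s * (a * tau) - s / 2 * (s * a - s * b) by ring.
    by rewrite bE; field.
  - apply: (mulfI (lt0r_neq0 s0)); rewrite mulr0 -/p.
    have -> : s * (a * tau ^+ 2 + b - 1 - p * (a - b))
      = s * (a * tau ^+ 2 - 1 - p * a) + (1 + p) * (s * b) by ring.
    rewrite bE; have := asq; lra.
  - rewrite addrC subr_le0 -(ler_pM2l s0) bE; nra.
move=> X c hX hB; apply: (@det_le_of_cover R m al be) => //; try lra.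
- by rewrite -[RHS]aE /q; ring.
- apply: (mulfI (lt0r_neq0 s0)); rewrite mn -/s -/p.
  have -> : s * (n%:R * (1 - s * tau + p) * b)
    = n%:R * (1 - s * tau + p) * (s * b) by ring.
  (* The second contact equation is [n - 1] times [asq] plus [a] times [quad]. *)
  have e1 := congr1 ( *%R (n%:R - 1)) asq.
  have := congr1 ( *%R a) quad; rewrite bE /M; lra.
Qed.

End Cases.

Theorem theorem6p6 (R : realType) (n : nat) (alpha beta : R)
    (hn : (2 <= n)%N) (halpha : -1 <= alpha) (hab : alpha < beta)
    (hbeta : beta <= 1) (hsq : alpha ^+ 2 <= beta ^+ 2) :
  let Delta := n%:R ^+ 2 * (beta ^+ 2 - alpha ^+ 2) ^+ 2
               + 4 * (1 - alpha ^+ 2) * (1 - beta ^+ 2) in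
  [/\ forall a b tau : R, 0 < a -> 0 < b ->
        (nlp_optimal n alpha beta a b tau <->
         CE (Bab n alpha beta) = E (diag1 n a b) (tau *: e1 R n)),
      alpha * beta <= - (1 / n%:R) ->
        forall a b tau : R,
          nlp_optimal n alpha beta a b tau <->
          [/\ tau = 0, a = 1 & b = 1],
      alpha + beta = 0 -> - (1 / n%:R) < alpha * beta ->
        forall a b tau : R,
          nlp_optimal n alpha beta a b tau <->
          [/\ tau = 0, a = 1 / (n%:R * beta ^+ 2) &
              b = (n%:R - 1) / (n%:R * (1 - beta ^+ 2))]
    & alpha + beta != 0 -> - (1 / n%:R) < alpha * beta ->
        forall a b tau : R,
          nlp_optimal n alpha beta a b tau <->
          [/\ tau = (n%:R * (beta + alpha) ^+ 2 + 2 * (1 + alpha * beta)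
                     - Num.sqrt Delta) / (2 * (n%:R + 1) * (beta + alpha)),
              a = 1 / (n%:R * (tau - alpha) * (beta - tau)) &
              b = (1 - a * (tau - alpha) ^+ 2) / (1 - alpha ^+ 2)]].
Proof.
case: n hn => [//|m] m1 Delta; have m0 : (0 < m)%N by [].
have s_ge0 : 0 <= alpha + beta.
  have d0 : 0 < beta - alpha by rewrite subr_gt0.
  by rewrite -(pmulr_rge0 _ d0) [alpha + beta]addrC -subr_sqr subr_ge0.
have ball := extremal_triple_ball m _ _ m0 halpha hab hbeta s_ge0.
have sym := extremal_triple_symmetric m _ _ m0 halpha hab hbeta.
have gen := extremal_triple_general m _ _ m0 halpha hab hbeta s_ge0.
split.
(* Both problems are characterized by the same triple, so the equivalence only needs one to exist,
   and the three cases are exhaustive. *)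
- suff [a0 [b0 [tau0 h]]] : exists a0 b0 tau0,
      extremal_triple m alpha beta a0 b0 tau0.
    move=> a b tau a_gt0 b_gt0.
    exact: iff_trans (nlp_optimalP m _ _ _ _ _ m0 h a b tau)
      (iff_sym (CE_P m _ _ _ _ _ m0 h a b tau a_gt0 b_gt0)).
  have [/ball h|gt] := leP (alpha * beta) (- (1 / m.+1%:R)).
    by do 3 eexists; exact: h.
  have [/sym h|ne] := eqVneq (alpha + beta) 0.
    by do 3 eexists; exact: h.
  by do 3 eexists; exact: gen.
- by move=> /ball h a b tau; exact: nlp_optimalP h a b tau.
- by move=> s0 /(sym s0) h a b tau; exact: nlp_optimalP h a b tau.
- move=> ne gt a b tau; have := nlp_optimalP m _ _ _ _ _ m0 (gen ne gt) a b tau.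
  (* The formulas for [a] and [b] mention the variables [tau] and [a]; substituting in this order
     gives the closed forms. *)
  by move=> ->; split=> [[-> -> ->]|[-> -> ->]].
Qed.
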